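(* Let $\alpha\in\mathbb{R}$, $b\in\mathbb{R}$, $b>1$. There is a constant $C=C(\alpha,b)>0$ such that for all $x\in\mathbb{R}$ the oscillatory integral $$J^{b,\alpha}(x)=\int_{\mathbb{R}}e^{i(|\xi|^b+x\xi)}|\xi|^\alpha\,d\xi$$ satisfies $$|J^{b,\alpha}(x)|\le C\begin{cases}(1+|x|)^{-1-\alpha}, & \text{if } -1<\alpha\le-\tfrac12,\\[2pt] (1+|x|)^{\frac1{b-1}\left(\alpha-\frac b2+1\right)}, & \text{if } -\tfrac12<\alpha<b-1.\end{cases}$$
   Context: The integral over $\mathbb{R}$ is understood as an (in general conditionally convergent) improper integral, i.e. as the limit of the integrals over $[-R_1,R_2]$ as $R_1,R_2\to\infty$; it converges for $-1<\alpha<b-1$. *)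

(* Defs.v *)
From HB Require Import structures.
From mathcomp Require Import all_boot all_order all_algebra.
From mathcomp Require Import all_classical all_reals all_analysis.
From mathcomp Require Import complex.
Set Implicit Arguments.
Unset Strict Implicit.
Unset Printing Implicit Defensive.
Import Order.TTheory GRing.Theory Num.Theory.
Import numFieldNormedType.Exports.
Local Open Scope classical_set_scope.
Local Open Scope ring_scope.
Local Open Scope complex_scope.

Definition expi (R : realType) (t : R) : R[i] := cos t +i* sin t.

(* For alpha < 0 the value at xi = 0 is the junk value 0 of [powR]; this only
   changes the integrand on a null set. *)
Definition osc_integrand (R : realType) (b alpha x xi : R) : R[i] :=
  expi (`|xi| `^ b + x * xi) * (`|xi| `^ alpha)%:C.

(* Lebesgue integral of a complex-valued function, by components. *)
Definition cintegral (R : realType) (D : set R) (f : R -> R[i]) : R[i] :=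
  (\int[lebesgue_measure]_(t in D) complex.Re (f t)) +i*
  (\int[lebesgue_measure]_(t in D) complex.Im (f t)).

(* The integral over [- r.1, r.2]. The codomain is [R[i]^o] because the
   topology of [R[i]] is declared on the regular algebra; the underlying
   metric is that of the complex modulus. *)
Definition osc_partial (R : realType) (b alpha x : R) (r : R * R) : R[i]^o :=
  cintegral `[- r.1, r.2] (osc_integrand b alpha x).

(* Both bounds go to infinity independently. *)
Definition osc_filter (R : realType) : set_system (R * R) :=
  filter_prod (pinfty_nbhs R) (pinfty_nbhs R).
Arguments osc_filter R : clear implicits.

Definition osc_converges (R : realType) (b alpha x : R) : Prop :=
  cvg (osc_partial b alpha x @ osc_filter R).

(* Meaningful only when [osc_converges b alpha x] holds. *)
Definition osc_integral (R : realType) (b alpha x : R) : R[i] :=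
  lim (osc_partial b alpha x @ osc_filter R).

(* Main.v *)
Require Import Defs.
From HB Require Import structures.
From mathcomp Require Import all_boot all_order all_algebra.
From mathcomp Require Import all_classical all_reals all_analysis.
From mathcomp Require Import complex.
From mathcomp Require Import measurable_realfun ring lra.
Import Order.TTheory GRing.Theory Num.Theory.
Import numFieldNormedType.Exports.
Local Open Scope classical_set_scope.
Local Open Scope ring_scope.

(** Splitting the line at 0 and reflecting the negative half turns the partial
    integrals into sums of two half-line primitives
      F(y) = \int_0^y cos (t^b + s t + theta) t^alpha dt,   s = x or s = - x,
    with theta = 0 for the real part and theta = - pi / 2 for the imaginary
    part. All the estimates only use two facts on F, recorded in
    [osc_primitive]: its derivative on the open half-line, and the trivial
    bound |F(y)| <= y^(1+alpha) / (1+alpha).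

    Away from the zeros of phi'(y) = b y^(b-1) + s the oscillation is exploited
    through h = y^alpha / phi'. The sign of h' is that of
    alpha s - b (b - 1 - alpha) y^(b-1), which is nonincreasing in y because
    alpha < b - 1; hence h has at most two monotone pieces, and the increment
    of F over an interval on which |h| <= M is at most 8 M
    ([van_der_corput_powR]).

    Let mu >= 1 be the point with b mu^(b-1) = |s|; it is stationary when
    s < 0. Put delta = mu^(1-b) / 2 and rho = mu^(1-b/2) / 2. The half-line is
    cut at delta <= mu/2 <= mu - rho < mu + rho <= 2 mu. Up to constants, the
    trivial bound on [0, delta] gives P = mu^((1-b)(1+alpha)), the length of
    [mu - rho, mu + rho] times the size mu^alpha of the amplitude gives
    Q = mu^(alpha+1-b/2), and [van_der_corput_powR] bounds every other piece by
    a multiple of P + Q ([osc_primitive_large]). On the tail it also gives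
    O(y^(alpha+1-b)), hence convergence ([cvg_osc_primitive]). In terms of
    |s| ~ mu^(b-1), P is |s|^(-1-alpha) and Q is
    |s|^((alpha+1-b/2)/(b-1)); the former dominates exactly when
    alpha <= - 1/2, which is the case distinction of the theorem. *)

(** * Increments controlled by derivatives *)

Section calculus.
Context {R : realType}.
Implicit Types (a c y : R) (f g h : R -> R).

Lemma ler_of_is_derive f f' a c : a <= c ->
  (forall y, a <= y <= c -> is_derive y 1 f (f' y)) ->
  (forall y, a <= y <= c -> 0 <= f' y) -> f a <= f c.
Proof.
move=> ac df f'0.
have dfo y : y \in `]a, c[%R -> is_derive y 1 f (f' y).
  by rewrite in_itv/= => /andP[ay yc]; apply: df; rewrite !ltW.
apply: (@ger0_derive1_le_cc _ f a c) => //; rewrite ?in_itv/= ?lexx ?ac//.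
- by move=> y /dfo[].
- move=> y yac; have [_] := dfo y yac; rewrite derive1E => ->.
  by apply: f'0; move: yac; rewrite in_itv/= => /andP[ay yc]; rewrite !ltW.
- apply: derivable_within_continuous => y; rewrite in_itv/= => yac.
  by have [] := df y yac.
Qed.

Lemma ler_dist_is_derive f f' g g' a c : a <= c ->
  (forall y, a <= y <= c -> is_derive y 1 f (f' y)) ->
  (forall y, a <= y <= c -> is_derive y 1 g (g' y)) ->
  (forall y, a <= y <= c -> `|f' y| <= g' y) ->
  `|f c - f a| <= g c - g a.
Proof.
move=> ac df dg fg.
have lo : (g - f) a <= (g - f) c.
  apply: (@ler_of_is_derive _ (g' - f')) => // y yac.
    by have := df _ yac; have := dg _ yac => ? ?; exact: is_deriveB.
  by have := fg _ yac; rewrite ler_norml => /andP[? ?]; rewrite !fctE/=; lra.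
have hi : (g + f) a <= (g + f) c.
  apply: (@ler_of_is_derive _ (g' + f')) => // y yac.
    by have := df _ yac; have := dg _ yac => ? ?; exact: is_deriveD.
  by have := fg _ yac; rewrite ler_norml => /andP[? ?]; rewrite !fctE/=; lra.
by move: lo hi; rewrite !fctE/= ler_norml; lra.
Qed.

(** Integration by parts without integrating: the derivative of
    F - h sin(phi) is - h' sin(phi), and it is dominated by |h'|, which is the
    derivative of h or of - h. The increment of F - h sin(phi) is therefore at
    most that of h in absolute value, i.e. 2 M, and h sin(phi) contributes 2 M
    more. *)
Lemma van_der_corput_monotone F (phi phi' h h' : R -> R) a c M : a <= c ->
  (forall y, a <= y <= c -> is_derive y 1 phi (phi' y)) ->
  (forall y, a <= y <= c -> is_derive y 1 h (h' y)) ->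
  (forall y, a <= y <= c -> is_derive y 1 F (cos (phi y) * (h y * phi' y))) ->
  (forall y, a <= y <= c -> 0 <= h' y) \/
  (forall y, a <= y <= c -> h' y <= 0) ->
  `|h a| <= M -> `|h c| <= M -> `|F c - F a| <= 4 * M.
Proof.
move=> ac dphi dh dF mono ha hc.
pose G y := F y - h y * sin (phi y).
have dG y : a <= y <= c -> is_derive y 1 G (- (h' y * sin (phi y))).
  move=> yac; have := dphi _ yac; have := dh _ yac; have := dF _ yac => ? ? ?.
  apply: is_derive_eq; rewrite /GRing.scale/=.
  ring.
have Gac : `|G c - G a| <= `|h c - h a|.
  have sin1 y : `|sin (phi y)| <= 1.
    by rewrite ler_norml sin_geN1 sin_le1.
  case: mono => mono.
    apply: le_trans (ler_norm _).
    apply: (ler_dist_is_derive _ _ _ _ _ _ ac dG dh) => y yac.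
    by rewrite normrN normrM (ger0_norm (mono _ yac)) ler_piMr ?mono.
  rewrite [leRHS]distrC; apply: le_trans (ler_norm _).
  have -> : h a - h c = (- h) c - (- h) a by rewrite !fctE opprK addrC.
  apply: (ler_dist_is_derive _ _ _ (fun y => - h' y) _ _ ac dG) => y yac.
    by have := dh _ yac => ?; exact: is_deriveN.
  rewrite normrN normrM (ler0_norm (mono _ yac)) ler_piMr// oppr_ge0.
  exact: mono.
have hs y : `|h y| <= M -> `|h y * sin (phi y)| <= M.
  move=> hM; rewrite normrM (le_trans _ hM)// ler_piMr//.
  by rewrite ler_norml sin_geN1 sin_le1.
have := hs a ha; have := hs c hc; move: ha hc Gac.
have : `|h c - h a| <= `|h c| + `|h a| by exact: ler_normB.
rewrite /G; set u := h c * _; set v := h a * _ => h1 h2 h3 h4 h5 h6.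
have -> : F c - F a = (F c - u - (F a - v)) + (u - v) by ring.
apply: le_trans (ler_normD _ _) _.
have := ler_normB u v.
lra.
Qed.

End calculus.

(** * First-derivative test for power amplitudes *)

Section half_line_phase.
Context {R : realType}.
Variables (alpha b s theta : R).
Hypotheses (hb : 1 < b) (hab : alpha < b - 1).

Definition half_line_phase (y : R) : R := y `^ b + s * y + theta.

Let phi' (y : R) : R := b * y `^ (b - 1) + s.

Let h (y : R) : R := y `^ alpha / phi' y.

(** Up to the positive factor y^(alpha-1) / phi'(y)^2, the derivative of
    y^alpha / phi'(y). *)
Let hnum (y : R) : R := alpha * s - b * (b - 1 - alpha) * y `^ (b - 1).

Let h' (y : R) : R := y `^ (alpha - 1) * hnum y / (phi' y) ^+ 2.

Let is_derive_phase (y : R) : 0 < y -> is_derive y 1 half_line_phase (phi' y).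
Proof.
move=> y0; have := @is_derive1_powR _ b _ y0 => ?.
rewrite /half_line_phase; apply: is_derive_eq.
  by rewrite /GRing.scale/= /phi'; ring.
Qed.

Let is_derive_phi' (y : R) : 0 < y ->
  is_derive y 1 phi' (b * ((b - 1) * y `^ (b - 1 - 1))).
Proof.
move=> y0; have := @is_derive1_powR _ (b - 1) _ y0 => ?.
rewrite /phi'; apply: is_derive_eq.
  by rewrite /GRing.scale/=; ring.
Qed.

Let powR_pred (y r : R) : 0 < y -> y `^ r = y * y `^ (r - 1).
Proof.
move=> y0; rewrite -{2}(@powRr1 _ y) ?ltW// -powRD ?(gt_eqF y0) ?implybT//.
by congr (_ `^ _); ring.
Qed.

Let is_derive_h (y : R) : 0 < y -> phi' y != 0 -> is_derive y 1 h (h' y).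
Proof.
move=> y0 py; have := @is_derive1_powR _ alpha _ y0 => ?.
have := is_deriveV py (is_derive_phi' y y0) => ?.
apply: is_derive_eq.
rewrite /GRing.scale/= /h' /hnum.
have -> : phi' y = b * (y * y `^ (b - 1 - 1)) + s by rewrite -powR_pred.
move: py; rewrite /phi' (powR_pred _ (b - 1) y0) (powR_pred _ alpha y0).
by move=> py; field.
Qed.

Let hnum_decr (y z : R) : 0 < y -> y <= z -> hnum z <= hnum y.
Proof.
have [hb1 hab1] := (hb, hab).
move=> y0 yz; rewrite /hnum lerD2l lerN2 ler_pM2l.
  by apply: ge0_ler_powR; rewrite ?nnegrE; lra.
by apply: mulr_gt0; lra.
Qed.

Let vdc_monotone (F : R -> R) (a c M : R) : 0 < a -> a <= c ->
  (forall y : R, 0 < y ->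
     is_derive y 1 F (cos (half_line_phase y) * y `^ alpha)) ->
  (forall y : R, a <= y <= c -> phi' y != 0) ->
  (forall y : R, a <= y <= c -> `|h y| <= M) ->
  (forall y : R, a <= y <= c -> 0 <= hnum y) \/
  (forall y : R, a <= y <= c -> hnum y <= 0) ->
  `|F c - F a| <= 4 * M.
Proof.
move=> a0 ac dF phi0 hM mono.
have pos y : a <= y <= c -> 0 < y by case/andP => /(lt_le_trans a0).
apply: (@van_der_corput_monotone _ F half_line_phase phi' h h') => //.
- by move=> y /pos; exact: is_derive_phase.
- by move=> y yac; apply: is_derive_h; [exact: pos|exact: phi0].
- move=> y yac; have -> : h y * phi' y = y `^ alpha by rewrite /h divfK// phi0.
  exact/dF/pos.
- by case: mono => mono; [left|right] => y yac; have := mono _ yac => hn;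
    rewrite /h' ?divr_ge0 ?sqr_ge0 ?mulr_ge0 ?powR_ge0//;
    rewrite mulr_le0_ge0 ?invr_ge0 ?sqr_ge0// mulr_ge0_le0 ?powR_ge0.
- by apply: hM; rewrite lexx.
- by apply: hM; rewrite lexx andbT.
Qed.

(** The quotient y^alpha / phi'(y) changes monotonicity at most once, so the
    interval splits into at most two on which [van_der_corput_monotone]
    applies. *)
Lemma van_der_corput_powR (F : R -> R) (a c M : R) : 0 < a -> a <= c ->
  (forall y : R, 0 < y ->
     is_derive y 1 F (cos (half_line_phase y) * y `^ alpha)) ->
  (forall y : R, a <= y <= c -> b * y `^ (b - 1) + s != 0) ->
  (forall y : R, a <= y <= c -> y `^ alpha <= M * `|b * y `^ (b - 1) + s|) ->
  `|F c - F a| <= 8 * M.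
Proof.
have [hb1 hab1] := (hb, hab).
move=> a0 ac dF phi0 hM'.
have hM y : a <= y <= c -> `|h y| <= M.
  move=> yac; rewrite /h normrM normfV ger0_norm ?powR_ge0//.
  by rewrite ler_pdivrMr ?normr_gt0 ?phi0//; exact: hM'.
have M0 : 0 <= M by apply: le_trans (hM a _); rewrite // lexx.
have [hnc|hnc] := leP 0 (hnum c).
  apply: (@le_trans _ _ (4 * M)); last lra.
  apply: vdc_monotone => //; left => y /andP[ay yc].
  by apply: le_trans hnc _; apply: hnum_decr => //; exact: lt_le_trans ay.
have [hna|hna] := leP (hnum a) 0.
  apply: (@le_trans _ _ (4 * M)); last lra.
  apply: vdc_monotone => //; right => y /andP[ay yc].
  by apply: le_trans hna; exact: hnum_decr.
(* the zero of the numerator of the derivative of y^alpha / phi'(y) *)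
pose m := (alpha * s / (b * (b - 1 - alpha))) `^ (b - 1)^-1.
have W0 : 0 < b * (b - 1 - alpha) by apply: mulr_gt0; lra.
have as0 : 0 < alpha * s.
  move: hna; rewrite /hnum subr_gt0; apply: le_lt_trans.
  by rewrite mulr_ge0// ?powR_ge0// ltW.
have mb : m `^ (b - 1) = alpha * s / (b * (b - 1 - alpha)).
  rewrite /m -powRrM mulVf ?powRr1//; last by lra.
  by rewrite divr_ge0// ltW.
have m0 : 0 < m by rewrite powR_gt0 // divr_gt0.
have hnm : hnum m = 0.
  by rewrite /hnum mb mulrCA mulfV ?gt_eqF// mulr1 subrr.
have am : a <= m.
  rewrite leNgt; apply/negP => ma.
  by have := hnum_decr _ _ m0 (ltW ma); rewrite hnm leNgt hna.
have mc : m <= c.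
  rewrite leNgt; apply/negP => cm.
  by have := hnum_decr _ _ (lt_le_trans a0 ac) (ltW cm); rewrite hnm leNgt hnc.
have e1 : `|F m - F a| <= 4 * M.
  apply: vdc_monotone => //.
  - by move=> y /andP[ay ym]; rewrite phi0// ay (le_trans ym).
  - by move=> y /andP[ay ym]; rewrite hM// ay (le_trans ym).
  - left => y /andP[ay ym]; rewrite -hnm; apply: hnum_decr => //.
    exact: lt_le_trans ay.
have e2 : `|F c - F m| <= 4 * M.
  apply: vdc_monotone => //.
  - by move=> y /andP[my yc]; rewrite phi0// yc (le_trans am).
  - by move=> y /andP[my yc]; rewrite hM// yc (le_trans am).
  - by right => y /andP[my yc]; rewrite -hnm; apply: hnum_decr.
have := ler_distD (F m) (F c) (F a).
lra.
Qed.

End half_line_phase.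

(** * Inequalities between powers *)

Section power_inequalities.
Context {R : realType}.
Implicit Types u v e k : R.

Lemma le0_ler_powR u v e : e <= 0 -> 0 < u -> u <= v -> v `^ e <= u `^ e.
Proof.
move=> e0 u0 uv; rewrite -[e]opprK !(powRN _ (- e)).
have v0 := lt_le_trans u0 uv.
rewrite lef_pV2 ?posrE ?powR_gt0//.
by apply: ge0_ler_powR; rewrite ?nnegrE ?oppr_ge0// ltW.
Qed.

(** Comparable positive quantities have comparable powers, whatever the sign
    of the exponent. This serves the amplitude on [mu/2, 2 mu] and the passage
    between |s| and 1 + |s|. *)
Lemma powR_comparable k u v e : 0 < u -> 0 < v ->
  u <= k * v -> v <= k * u -> u `^ e <= k `^ `|e| * v `^ e.
Proof.
move=> u0 v0 ukv vku.
have k0 : 0 < k by rewrite -(pmulr_lgt0 _ v0) (lt_le_trans u0).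
have k0' := ltW k0; have u0' := ltW u0; have v0' := ltW v0.
have [e0|/ltW e0] := leP 0 e.
  rewrite ger0_norm// -powRM//.
  by apply: ge0_ler_powR; rewrite ?nnegrE// mulr_ge0.
rewrite ler0_norm// powRN mulrC ler_pdivlMr ?powR_gt0//.
rewrite -powRM// mulrC.
exact: le0_ler_powR.
Qed.

Lemma powR_gap_far u v e : 0 <= e -> 0 <= u -> 2 * u <= v ->
  (1 - 2 `^ (- e)) * v `^ e <= v `^ e - u `^ e.
Proof.
move=> e0 u0 uv; have v0 : 0 <= v by lra.
rewrite mulrBl mul1r lerD2l lerN2 powRN mulrC ler_pdivlMr ?powR_gt0//.
by rewrite -powRM//; apply: ge0_ler_powR; rewrite ?nnegrE//; lra.
Qed.

(** With r = ln (v / u): v^e / u^e = exp (e r) >= 1 + e r, and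
    r >= 1 - u / v. *)
Lemma powR_gap_near u v e : 0 <= e -> 0 < u -> u <= v ->
  e * u `^ e * ((v - u) / v) <= v `^ e - u `^ e.
Proof.
move=> e0 u0 uv; have v0 := lt_le_trans u0 uv.
have lnuv : ln (u / v) <= u / v - 1.
  have uv0 : 0 < u / v by exact: divr_gt0.
  have := @le_ln1Dx R (u / v - 1).
  by rewrite (_ : 1 + (u / v - 1) = u / v); [apply; lra|ring].
have -> : v `^ e = u `^ e * expR (- (e * ln (u / v))).
  rewrite /powR !gt_eqF// -expRD; congr expR.
  by rewrite lnM ?posrE ?invr_gt0// lnV ?posrE//; ring.
have -> : e * u `^ e * ((v - u) / v) = u `^ e * (e * ((v - u) / v)) by ring.
rewrite -[X in _ <= _ - X]mulr1 -mulrBr ler_wpM2l ?powR_ge0// lerBrDl.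
apply: le_trans (expR_ge1Dx _); rewrite lerD2l -mulrN ler_wpM2l//.
by rewrite mulrBl divff ?gt_eqF//; lra.
Qed.

End power_inequalities.

(** * Estimates of the half-line primitives *)

(** When |s| = b mu^(b-1), |phi'(y)| is at least [far_speed b * y^(b-1)] for
    y >= 2 mu, and at least [far_speed b * mu^(b-1)] for y <= mu/2. *)
Definition far_speed {R : realType} (b : R) : R := b * (1 - 2 `^ (- (b - 1))).

(** When |s| = b mu^(b-1), |phi'(y)| is at least
    [near_speed b * mu^(b-2) * |y - mu|] for y in [mu/2, 2 mu]. *)
Definition near_speed {R : realType} (b : R) : R :=
  b * ((b - 1) * 2 `^ (- (b - 1)) / 2).

Lemma far_speed_gt0 (R : realType) (b : R) : 1 < b -> 0 < far_speed b.
Proof.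
move=> hb; apply: mulr_gt0; first exact: lt_trans hb.
rewrite subr_gt0 powRN invf_lt1 ?powR_gt0//.
rewrite -[ltLHS](powRr0 2) /powR !gt_eqF// ltr_expR ltr_pM2r ?subr_gt0//.
by rewrite ln_gt0// ltr1n.
Qed.

Lemma near_speed_gt0 (R : realType) (b : R) : 1 < b -> 0 < near_speed b.
Proof.
move=> hb; apply: mulr_gt0; first exact: lt_trans hb.
by rewrite !mulr_gt0 ?powR_gt0// subr_gt0.
Qed.

Section primitive_estimates.
Context {R : realType}.
Variables (alpha b : R).
Hypotheses (hb : 1 < b) (ha : -1 < alpha) (hab : alpha < b - 1).

(** All that is used of the integral from 0 to y. The behaviour at 0 enters
    through the second clause only, since for alpha < 0 the amplitude blows up
    there. *)
Definition osc_primitive (s theta : R) (F : R -> R) : Prop :=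
  (forall y : R, 0 < y ->
     is_derive y 1 F (cos (half_line_phase b s theta y) * y `^ alpha)) /\
  (forall y : R, 0 < y -> `|F y| <= y `^ (1 + alpha) / (1 + alpha)).

Local Notation beta := (b - 1).

Local Notation cfar := (far_speed b).
Local Notation cnear := (near_speed b).

Let beta_gt0 : 0 < beta.
Proof. by rewrite subr_gt0. Qed.

Let b_gt0 : 0 < b.
Proof. exact: lt_trans hb. Qed.

Let cfar_gt0 : 0 < cfar. Proof. exact: far_speed_gt0. Qed.

Let cnear_gt0 : 0 < cnear. Proof. exact: near_speed_gt0. Qed.

Section fixed_frequency.
Variables (s theta : R) (F : R -> R).
Hypothesis oF : osc_primitive s theta F.

(** Only an upper bound on |s| is required, so that low frequencies are covered
    by mu = 1. *)
Lemma osc_primitive_tail mu a c : 0 < mu -> `|s| <= b * mu `^ beta ->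
  2 * mu <= a -> a <= c ->
  `|F c - F a| <= 8 * (a `^ (alpha - beta) / cfar).
Proof.
move=> mu0 smu mua ac; have hab1 := hab.
have a0 : 0 < a by lra.
have gap y : a <= y <= c -> 0 < y /\ cfar * y `^ beta <= `|b * y `^ beta + s|.
  move=> /andP[ay yc]; have y0 := lt_le_trans a0 ay; split=> //.
  have := @powR_gap_far R mu y beta (ltW beta_gt0) (ltW mu0) ltac:(lra).
  rewrite -(ler_pM2l b_gt0) mulrA -/(far_speed b) mulrBr => h.
  have := ler_norm (b * y `^ beta + s).
  by move: smu; rewrite ler_norml => /andP[]; lra.
case: oF => dF _.
apply: (@van_der_corput_powR R alpha b s theta hb hab F a c) => //.
- move=> y /gap[y0 gy]; rewrite -normr_gt0 (lt_le_trans _ gy)//.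
  by rewrite mulr_gt0// powR_gt0.
- move=> y yac; have [y0 gy] := gap y yac.
  apply: le_trans (ler_wpM2l _ gy); last first.
    by rewrite divr_ge0 ?powR_ge0// ltW.
  rewrite mulrA divfK ?gt_eqF//.
  have -> : y `^ alpha = y `^ (alpha - beta) * y `^ beta.
    by rewrite -powRD ?subrK// (gt_eqF y0) implybT.
  rewrite ler_wpM2r ?powR_ge0//; apply: le0_ler_powR => //; first lra.
  by case/andP: yac.
Qed.

Lemma osc_primitive_small c : `|s| <= b -> 2 <= c ->
  `|F c| <= 2 `^ (1 + alpha) / (1 + alpha) + 8 * (2 `^ (alpha - beta) / cfar).
Proof.
move=> sb c2.
have := @osc_primitive_tail 1 2 c ltr01.
rewrite powR1 !mulr1 => /(_ sb (lexx _) c2) h1.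
have h2 := oF.2 2 (ltr0n _ _).
have := ler_normD (F c - F 2) (F 2); rewrite subrK.
lra.
Qed.

Section frequency_scale.
Variable mu : R.
Hypotheses (mu1 : 1 <= mu) (smu : `|s| = b * mu `^ beta).

Let mu_gt0 : 0 < mu. Proof. exact: lt_le_trans mu1. Qed.

Let P : R := mu `^ (- (beta * (1 + alpha))).
Let Q : R := mu `^ (alpha + 1 - b / 2).

Let P_ge0 : 0 <= P. Proof. exact: powR_ge0. Qed.
Let Q_ge0 : 0 <= Q. Proof. exact: powR_ge0. Qed.

(** The sign of s is immaterial: phi' is bounded below by the distance between
    |s| and b y^(b-1), so that both half-lines are treated at once. *)
Let phase_gap y : b * `|mu `^ beta - y `^ beta| <= `|b * y `^ beta + s|.
Proof.
rewrite -[X in X * _ <= _](ger0_norm (ltW b_gt0)) -normrM mulrBr -smu.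
have by0 : 0 <= b * y `^ beta by rewrite mulr_ge0 ?powR_ge0// ltW.
have := ler_dist_dist (b * y `^ beta) (- s).
by rewrite opprK normrN (ger0_norm by0) distrC.
Qed.

Let piece (a c M : R) : 0 < a -> a <= c -> 0 <= M ->
  (forall y : R, a <= y <= c ->
     y `^ alpha <= M * (b * `|mu `^ beta - y `^ beta|)) ->
  `|F c - F a| <= 8 * M.
Proof.
move=> a0 ac M0 hM; case: oF => dF _.
have pos y : a <= y <= c -> 0 < y by case/andP => /(lt_le_trans a0).
apply: (@van_der_corput_powR R alpha b s theta hb hab F a c) => //.
- move=> y yac; rewrite -normr_gt0; apply: lt_le_trans (phase_gap y).
  rewrite -(@pmulr_rgt0 _ M); last first.
    rewrite lt_neqAle M0 andbT; apply/eqP => M00.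
    by have := hM y yac; rewrite -M00 mul0r leNgt powR_gt0// pos.
  by apply: lt_le_trans (hM y yac); rewrite powR_gt0// pos.
- move=> y yac; apply: le_trans (hM y yac) _.
  by rewrite ler_wpM2l// phase_gap.
Qed.

Let powR_near (y : R) : mu / 2 <= y <= 2 * mu ->
  y `^ alpha <= 2 `^ `|alpha| * mu `^ alpha.
Proof.
have m0 := mu_gt0; move=> /andP[y1 y2].
by apply: powR_comparable; lra.
Qed.

Let powR_leQ : mu `^ (alpha - beta) <= Q.
Proof. by have hb1 := hb; apply: ler_powR => //; lra. Qed.

(** Half-width of the neighbourhood of mu where oscillation is not used:
    mu^(1-b/2) is phi''(mu)^(-1/2) up to a constant, the scale at which the
    trivial bound and the first-derivative test give the same order. *)
Let rho : R := mu `^ (1 - b / 2) / 2.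

Let rho_gt0 : 0 < rho. Proof. by rewrite divr_gt0 ?powR_gt0. Qed.

Let rho_le : rho <= mu / 2.
Proof.
rewrite ler_pM2r ?invr_gt0//.
rewrite -[leRHS](powRr1 (ltW mu_gt0)); apply: ler_powR => //.
by have hb1 := hb; lra.
Qed.

(** Of the order of 1 / |s|: below it the phase varies by a bounded amount, so
    that there is no oscillation to exploit. *)
Let delta : R := mu `^ (- beta) / 2.

Let delta_gt0 : 0 < delta. Proof. by rewrite divr_gt0 ?powR_gt0. Qed.

Let delta_le : delta <= mu / 2.
Proof.
rewrite ler_pM2r ?invr_gt0//.
rewrite -[leRHS](powRr1 (ltW mu_gt0)); apply: ler_powR => //.
by have hb1 := hb; lra.
Qed.

Let near_origin : `|F delta| <= (1 + alpha)^-1 * P.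
Proof.
have ha1 := ha.
apply: le_trans (oF.2 _ delta_gt0) _.
rewrite mulrC; apply: ler_wpM2l; first by rewrite invr_ge0; lra.
rewrite /delta powRM ?powR_ge0// -powRrM mulNr ler_piMr ?powR_ge0//.
apply: (@le_trans _ _ (1 `^ (1 + alpha))); last by rewrite powR1.
by apply: ge0_ler_powR; rewrite ?nnegrE ?invr_ge0// ?invf_le1 ?ler1n//; lra.
Qed.

Let before_stationary :
  `|F (mu / 2) - F delta| <= 8 * ((2 `^ (- alpha) * P + Q) / cfar).
Proof.
have [ha1 hab1] := (ha, hab).
have b0 := ltW beta_gt0.
have M0 : 0 <= (2 `^ (- alpha) * P + Q) / cfar.
  by apply: divr_ge0; [apply: addr_ge0 => //; exact: mulr_ge0|exact: ltW].
apply: piece => //.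
move=> y /andP[dy ym].
have y0 := lt_le_trans delta_gt0 dy.
have gap := @powR_gap_far R y mu beta b0 (ltW y0) ltac:(lra).
apply: (@le_trans _ _ ((2 `^ (- alpha) * P + Q) / cfar * (cfar * mu `^ beta))).
  rewrite mulrA divfK ?gt_eqF// mulrDl.
  (* y^alpha is largest at delta when alpha < 0, and at most mu^alpha else;
     the two contributions are P and Q *)
  have dE : delta `^ alpha = 2 `^ (- alpha) * P * mu `^ beta.
    rewrite /delta powRM ?powR_ge0 ?invr_ge0// -powRrM mulrC.
    rewrite -(@powR_inv1 _ 2)// -powRrM mulN1r -mulrA -powRD; last first.
      by rewrite (gt_eqF mu_gt0) implybT.
    by congr (_ * _ `^ _); ring.
  have mE : mu `^ alpha <= Q * mu `^ beta.
    have -> : mu `^ alpha = mu `^ (alpha - beta) * mu `^ beta.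
      by rewrite -powRD ?subrK// (gt_eqF mu_gt0) implybT.
    by rewrite ler_wpM2r ?powR_ge0.
  have := powR_ge0 delta alpha; have := powR_ge0 mu alpha.
  have [a0|a0] := leP 0 alpha.
    have : y `^ alpha <= mu `^ alpha.
      by apply: ge0_ler_powR; rewrite ?nnegrE// ?ltW//; have := mu_gt0; lra.
    by rewrite -dE; lra.
  have : y `^ alpha <= delta `^ alpha.
    exact: le0_ler_powR (ltW a0) delta_gt0 dy.
  by rewrite -dE; lra.
apply: ler_wpM2l => //; rewrite /far_speed -mulrA ler_pM2l//.
by apply: le_trans gap _; exact: ler_norm.
Qed.

Let gap_near (y : R) : mu / 2 <= y <= 2 * mu ->
  cnear * (mu `^ beta * (`|y - mu| / mu)) <= b * `|mu `^ beta - y `^ beta|.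
Proof.
move=> /andP[y1 y2]; rewrite /near_speed -mulrA ler_pM2l//.
have m0 := mu_gt0; have y0 : 0 < y by lra.
have b0 := beta_gt0.
have p2 : 2 `^ (- beta) <= 1 :> R.
  by rewrite -[leRHS](powRr0 2); apply: ler_powR; rewrite ?ler1n// oppr_le0 ltW.
have [my|ym] := leP mu y.
  have gap := powR_gap_near _ _ _ (ltW b0) m0 my.
  rewrite [leRHS]distrC; apply: le_trans (le_trans gap (ler_norm _)).
  rewrite ger0_norm ?subr_ge0//.
  have -> : beta * 2 `^ (- beta) / 2 * (mu `^ beta * ((y - mu) / mu)) =
    beta * mu `^ beta * ((y - mu) * (2 `^ (- beta) / (2 * mu))).
    by field; rewrite gt_eqF.
  rewrite ler_wpM2l ?mulr_ge0 ?powR_ge0 ?(ltW b0)// ler_wpM2l ?subr_ge0//.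
  rewrite ler_pdivrMr ?mulr_gt0// mulrC ler_pdivlMr//.
  by apply: le_trans y2; rewrite ler_piMl// ltW.
have gap := powR_gap_near _ _ _ (ltW b0) y0 (ltW ym).
apply: le_trans (le_trans gap (ler_norm _)).
rewrite distrC ger0_norm ?subr_ge0; last exact: ltW.
have D0 : 0 <= (mu - y) / mu by rewrite divr_ge0 ?subr_ge0// ltW.
have -> : beta * 2 `^ (- beta) / 2 * (mu `^ beta * ((mu - y) / mu)) =
  beta * (2 `^ (- beta) * mu `^ beta / 2) * ((mu - y) / mu) by ring.
apply: ler_wpM2r => //; apply: ler_wpM2l; first exact: ltW.
apply: (@le_trans _ _ (2 `^ (- beta) * mu `^ beta)).
  by rewrite ler_piMr ?mulr_ge0 ?powR_ge0// invf_le1 ?ler1n.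
rewrite powRN mulrC ler_pdivrMr ?powR_gt0//.
rewrite -powRM; [|exact: ltW|exact: ler0n].
by apply: ge0_ler_powR; rewrite ?nnegrE; lra.
Qed.

Let near_stationary (a c : R) : mu / 2 <= a -> a <= c -> c <= 2 * mu ->
  (forall y, a <= y <= c -> rho <= `|y - mu|) ->
  `|F c - F a| <= 8 * (2 * 2 `^ `|alpha| / cnear * Q).
Proof.
move=> ma ac cm far; have m0 := mu_gt0.
have K0 : 0 <= 2 * 2 `^ `|alpha| / cnear.
  by rewrite divr_ge0 ?mulr_ge0 ?powR_ge0// ltW.
apply: piece => //; [lra|by rewrite mulr_ge0 ?powR_ge0|].
move=> y yac; have yn : mu / 2 <= y <= 2 * mu.
  by case/andP: yac => ay yc; apply/andP; split; lra.
apply: le_trans (powR_near _ yn) _.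
apply: le_trans; last first.
  by apply: ler_wpM2l (gap_near _ yn); rewrite mulr_ge0 ?powR_ge0.
apply: (@le_trans _ _ (2 * 2 `^ `|alpha| / cnear * Q *
    (cnear * (mu `^ beta * (rho / mu))))); last first.
  apply: ler_wpM2l; first exact: mulr_ge0.
  rewrite ler_pM2l//; apply: ler_wpM2l; first exact: powR_ge0.
  by rewrite ler_pM2r ?invr_gt0// far.
have -> : mu `^ alpha = Q * (mu `^ beta * (mu `^ (1 - b / 2) * mu `^ (- 1))).
  have nz e : e ==> (mu != 0) by rewrite (gt_eqF m0) implybT.
  by rewrite -!powRD//; congr (_ `^ _); field.
rewrite (powR_inv1 (ltW m0)) /rho le_eqVlt; apply/orP; left; apply/eqP.
by field; rewrite !gt_eqF.
Qed.

Let across_stationary : `|F (mu + rho) - F (mu - rho)| <= 2 `^ `|alpha| * Q.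
Proof.
have m0 := mu_gt0; have r0 := rho_gt0; have rm := rho_le.
case: oF => dF _.
pose K := 2 `^ `|alpha| * mu `^ alpha.
apply: (@le_trans _ _ (K * (mu + rho) - K * (mu - rho))).
  apply: (@ler_dist_is_derive _ F
    (fun y => cos (half_line_phase b s theta y) * y `^ alpha)
    (fun y => K * y) (fun=> K)); first lra.
  - by move=> y /andP[y1 y2]; apply: dF; lra.
  - by move=> y _; apply: is_derive_eq; rewrite /GRing.scale/=; ring.
  - move=> y /andP[y1 y2]; rewrite normrM (ger0_norm (powR_ge0 _ _)).
    apply: le_trans (powR_near y _); last by apply/andP; split; lra.
    by rewrite ler_piMl ?powR_ge0// ler_norml cos_geN1 cos_le1.
rewrite le_eqVlt; apply/orP; left; apply/eqP.
have -> : Q = mu `^ alpha * mu `^ (1 - b / 2).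
  by rewrite -powRD ?(gt_eqF m0) ?implybT//; congr (_ `^ _); ring.
by rewrite /K /rho; field.
Qed.

Let after_stationary c : 2 * mu <= c -> `|F c - F (2 * mu)| <= 8 * (Q / cfar).
Proof.
move=> mc; have m0 := mu_gt0; have hab1 := hab.
apply: le_trans (@osc_primitive_tail mu _ c m0 _ (lexx _) mc) _.
  by rewrite smu.
rewrite ler_pM2l// ler_pM2r ?invr_gt0//; apply: le_trans powR_leQ.
by apply: le0_ler_powR => //; lra.
Qed.

(** The six pieces cut at delta, mu/2, mu - rho, mu + rho and 2 mu are added
    up; each is at most a constant times P or Q. *)
Lemma osc_primitive_large c : 2 * mu <= c ->
  `|F c| <= ((1 + alpha)^-1 + 8 * (2 `^ (- alpha) / cfar) + 16 / cfar
             + 16 * (2 * 2 `^ `|alpha| / cnear) + 2 `^ `|alpha|)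
            * (mu `^ (- (beta * (1 + alpha))) + mu `^ (alpha + 1 - b / 2)).
Proof.
move=> mc; rewrite -/P -/Q.
have m0 := mu_gt0; have r0 := rho_gt0; have rm := rho_le.
have h1 := near_origin; have h2 := before_stationary.
have h4 := across_stationary; have h6 := after_stationary _ mc.
have h3 : `|F (mu - rho) - F (mu / 2)| <= 8 * (2 * 2 `^ `|alpha| / cnear * Q).
  apply: near_stationary; [lra|lra|lra|move=> y /andP[y1 y2]].
  by rewrite distrC; apply: le_trans (ler_norm _); lra.
have h5 : `|F (2 * mu) - F (mu + rho)| <= 8 * (2 * 2 `^ `|alpha| / cnear * Q).
  apply: near_stationary; [lra|lra|lra|move=> y /andP[y1 y2]].
  by apply: le_trans (ler_norm _); lra.
have P0 := P_ge0; have Q0 := Q_ge0.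
have tri : `|F c| <= `|F delta| + `|F (mu / 2) - F delta| +
   `|F (mu - rho) - F (mu / 2)| + `|F (mu + rho) - F (mu - rho)| +
   `|F (2 * mu) - F (mu + rho)| + `|F c - F (2 * mu)|.
  have {1}-> : F c = F delta + (F (mu / 2) - F delta) +
   (F (mu - rho) - F (mu / 2)) + (F (mu + rho) - F (mu - rho)) +
   (F (2 * mu) - F (mu + rho)) + (F c - F (2 * mu)) by ring.
  by do 4!(apply: le_trans (ler_normD _ _) _; rewrite lerD2r); exact: ler_normD.
have k1 : 0 <= (1 + alpha)^-1 by rewrite invr_ge0; have := ha; lra.
have k2 : 0 <= 2 `^ (- alpha) / cfar by rewrite divr_ge0 ?powR_ge0// ltW.
have k3 : 0 <= cfar^-1 by rewrite invr_ge0 ltW.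
have k4 : 0 <= 2 * 2 `^ `|alpha| / cnear.
  by rewrite divr_ge0 ?mulr_ge0 ?powR_ge0// ltW.
have k5 : 0 <= 2 `^ `|alpha| :> R by exact: powR_ge0.
apply: le_trans tri _.
move: h1 h2 h3 h4 h5 h6 k1 k2 k3 k4 k5.
rewrite [(_ * P + Q) / cfar]mulrDl [_ * P / cfar]mulrAC.
set A1 := (1 + alpha)^-1; set A2 := 2 `^ (- alpha) / cfar; set A3 := cfar^-1.
set A4 := 2 * 2 `^ `|alpha| / cnear; set A5 := 2 `^ `|alpha|.
have pr (x y : R) : 0 <= x -> 0 <= y -> 0 <= x * y by move=> *; exact: mulr_ge0.
move=> h1 h2 h3 h4 h5 h6 k1 k2 k3 k4 k5.
have := pr _ _ k1 Q0; have := pr _ _ k2 Q0; have := pr _ _ k3 P0.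
have := pr _ _ k4 P0; have := pr _ _ k5 P0; have := pr _ _ k3 Q0.
lra.
Qed.

End frequency_scale.
End fixed_frequency.
End primitive_estimates.

(** * Limits of the primitives and their decay in the frequency *)

Section primitive_limit.
Context {R : realType}.
Variables (alpha b : R).
Hypotheses (hb : 1 < b) (ha : -1 < alpha) (hab : alpha < b - 1).

Let beta_gt0 : 0 < b - 1. Proof. by rewrite subr_gt0. Qed.

Let b_gt0 : 0 < b. Proof. exact: lt_trans hb. Qed.

Let frequency_scale (u : R) : 1 <= u ->
  1 <= u `^ (b - 1)^-1 /\ (u `^ (b - 1)^-1) `^ (b - 1) = u.
Proof.
move=> u1; split.
  by rewrite -[leLHS](powRr0 u); apply: ler_powR => //; rewrite invr_ge0 ltW.
by rewrite -powRrM mulVf ?gt_eqF// powRr1// (le_trans _ u1).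
Qed.

Lemma cvg_osc_primitive s theta F :
  osc_primitive alpha b s theta F -> cvg (F y @[y --> +oo]).
Proof.
move=> oF; have b0 := b_gt0; have hab1 := hab.
have [mu1 muE] := @frequency_scale (1 + `|s| / b)
  ltac:(by rewrite lerDl divr_ge0// ltW).
set mu := _ `^ _ in mu1 muE.
have smu : `|s| <= b * mu `^ (b - 1).
  by rewrite muE mulrDr mulr1 mulrC divfK ?gt_eqF// lerDr ltW.
have mu0 : 0 < mu by apply: lt_le_trans mu1.
have K0 := @far_speed_gt0 _ b hb.
set K := far_speed b in K0.
apply/cauchy_cvgP/cauchy_exP => e e0.
(* beyond the second term the tail bound 8 A^(alpha-b+1) / K is at most e/2 *)
pose A := Num.max (2 * mu) ((e * K / 16) `^ (alpha - (b - 1))^-1).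
have A0 : 0 < A by rewrite lt_max mulr_gt0.
exists (F A).
change (\forall y \near +oo, ball (F A) e (F y)); near=> y.
have Ay : A <= y by near: y; exact: nbhs_pinfty_ge (num_real _).
rewrite /ball/= distrC.
apply: le_lt_trans
  (osc_primitive_tail _ _ hb hab _ _ _ oF mu _ _ mu0 smu _ Ay) _.
  by rewrite le_max lexx.
have eK : A `^ (alpha - (b - 1)) <= e * K / 16.
  rewrite [leRHS](_ : _ =
    ((e * K / 16) `^ (alpha - (b - 1))^-1) `^ (alpha - (b - 1))); last first.
    rewrite -powRrM mulVf; last by lra.
    by rewrite powRr1// divr_ge0// mulr_ge0// ltW.
  apply: le0_ler_powR; first lra.
    by rewrite powR_gt0// divr_gt0// mulr_gt0.
  by rewrite le_max lexx orbT.
rewrite -/K mulrA ltr_pdivrMr//.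
have : 0 < e * K by exact: mulr_gt0.
lra.
Unshelve. all: by end_near. Qed.

(** The two hypotheses say that P and Q are at most mu^((b-1) e), which is of
    the order of |s|^e. Frequencies |s| <= b, whose mu would be at most 1, are
    handled by [osc_primitive_small]. The bound is only claimed for large y,
    with a threshold depending on s; this suffices for the limit. *)
Lemma osc_primitive_bound e :
  - ((b - 1) * (1 + alpha)) <= (b - 1) * e ->
  alpha + 1 - b / 2 <= (b - 1) * e ->
  exists2 C : R, 0 < C & forall s theta F, osc_primitive alpha b s theta F ->
    \forall y \near +oo, `|F y| <= C * (1 + `|s|) `^ e.
Proof.
move=> eP eQ; have b0 := b_gt0; have ha1 := ha.
pose C0 : R := 2 `^ (1 + alpha) / (1 + alpha) +
  8 * (2 `^ (alpha - (b - 1)) / far_speed b).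
pose C1 : R := (1 + alpha)^-1 +
  8 * (2 `^ (- alpha) / far_speed b) +
  16 / far_speed b +
  16 * (2 * 2 `^ `|alpha| / near_speed b) +
  2 `^ `|alpha|.
have K0 := @far_speed_gt0 _ b hb.
have K1 := @near_speed_gt0 _ b hb.
have a10 : 0 < 1 + alpha by lra.
have pw (u v K : R) : 0 < K -> 0 <= u `^ v / K.
  by move=> K_gt0; rewrite divr_ge0 ?powR_ge0// ltW.
have C00 : 0 <= C0.
  by apply: addr_ge0; [exact: pw|apply: mulr_ge0 => //; exact: pw].
have C10 : 0 <= C1.
  rewrite /C1 -[2 * _ / _]mulrA.
  apply: addr_ge0; last exact: powR_ge0.
  apply: addr_ge0; last by do 2!apply: mulr_ge0 => //; exact: pw.
  apply: addr_ge0; last by rewrite divr_ge0// ltW.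
  apply: addr_ge0; last by apply: mulr_ge0 => //; exact: pw.
  by rewrite invr_ge0 ltW.
exists (C0 * (1 + b) `^ `|e| + C1 * 2 * (2 * b) `^ `|e| + 1).
  by rewrite ltr_wpDl// addr_ge0 ?mulr_ge0 ?powR_ge0.
move=> s theta F oF.
have se0 : 0 <= (1 + `|s|) `^ e by exact: powR_ge0.
have s0 := normr_ge0 s.
have [sb|/ltW bs] := leP `|s| b.
  near=> y.
  have y2 : 2 <= y by near: y; exact: nbhs_pinfty_ge (num_real _).
  apply: le_trans (osc_primitive_small _ _ hb hab _ _ _ oF _ sb y2) _.
  rewrite -/C0 -addrA mulrDl; apply: ler_wpDr.
    by rewrite mulr_ge0// addr_ge0// !mulr_ge0// ?powR_ge0//.
  rewrite -mulrA ler_peMr//.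
  have bs0 : 0 <= b * `|s| by rewrite mulr_ge0// ltW.
  have := @powR_comparable R (1 + b) 1 (1 + `|s|) e.
  by rewrite powR1; apply; lra.
have sb1 : 1 <= `|s| / b by rewrite ler_pdivlMr// mul1r.
have [mu1 muE] := frequency_scale _ sb1.
set mu := _ `^ _ in mu1 muE.
have smu : `|s| = b * mu `^ (b - 1) by rewrite muE mulrC divfK// gt_eqF.
near=> y.
have y2 : 2 * mu <= y by near: y; exact: nbhs_pinfty_ge (num_real _).
apply: le_trans (osc_primitive_large _ _ hb ha hab _ _ _ oF _ mu1 smu _ y2) _.
rewrite -/C1.
have PQ : mu `^ (- ((b - 1) * (1 + alpha))) + mu `^ (alpha + 1 - b / 2) <=
    2 * (`|s| / b) `^ e.
  rewrite -muE -powRrM mulr_natl mulr2n.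
  by apply: lerD; apply: ler_powR.
have sE : (`|s| / b) `^ e <= (2 * b) `^ `|e| * (1 + `|s|) `^ e.
  apply: powR_comparable; [lra|lra| |].
    rewrite ler_pdivrMr// mulrC.
    have b1 := ltW hb; have bb1 : 1 <= b * b by exact: mulr_ege1.
    have : `|s| <= `|s| * (b * b) by rewrite ler_peMr.
    lra.
  have -> : 2 * b * (`|s| / b) = 2 * `|s| by field; rewrite gt_eqF.
  by have := hb => ?; lra.
rewrite [leRHS]mulrDl [X in _ <= X + _]mulrDl mul1r.
apply: (@le_trans _ _ (C1 * 2 * (2 * b) `^ `|e| * (1 + `|s|) `^ e)).
  rewrite -[leRHS]mulrA -[leRHS]mulrA; apply: ler_wpM2l => //.
  apply: le_trans PQ _.
  by rewrite ler_pM2l.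
have : 0 <= C0 * (1 + b) `^ `|e| * (1 + `|s|) `^ e.
  by rewrite !mulr_ge0 ?powR_ge0.
lra.
Unshelve. all: by end_near. Qed.

End primitive_limit.

(** * Integrability of the amplitude at the origin *)

Section powR_integral.
Context {R : realType}.
Local Notation mu := (@lebesgue_measure R).

(** Monotone convergence along the intervals [y / (n+2), y], which exhaust
    ]0, y]. *)
Lemma ge0_integral_itv0_le (f : R -> R) (y C : R) : 0 < y ->
  measurable_fun [set: R] f -> (forall t, 0 <= f t) ->
  (forall d : R, 0 < d < y -> (\int[mu]_(t in `[d, y]) (f t)%:E <= C%:E)%E) ->
  (\int[mu]_(t in `[0%R, y]) (f t)%:E <= C%:E)%E.
Proof.
move=> y0 mf f0 fC.
have mfE (D : set R) : measurable D -> measurable_fun D (EFin \o f).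
  by move=> mD; apply/measurable_EFinP; exact: measurable_funS mf.
rewrite -integral_itv_obnd_cbnd; last exact: mfE.
pose d (n : nat) : R := y / n.+2%:R.
have d0 n : 0 < d n < y.
  by rewrite divr_gt0//= ltr_pdivrMr// ltr_pMr// ltr1n.
pose g (n : nat) : R -> \bar R := (EFin \o f) \_ `[d n, y].
have g0 n t : (0 <= g n t)%E.
  by rewrite /g patchE; case: ifPn => // _; rewrite lee_fin.
have mg n : measurable_fun `]0, y] (g n).
  apply: (measurable_funS measurableT) => //.
  by apply/(measurable_restrictT _ _).1 => //; exact: mfE.
have ndg t : `]0, y]%classic t -> nondecreasing_seq (g ^~ t).
  move=> /= _ m n mn; rewrite /g !patchE.
  case: ifPn => [|_]; last by case: ifPn => // _; rewrite lee_fin.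
  rewrite inE/= in_itv/= => /andP[dt ty].
  rewrite mem_set//= in_itv/= ty andbT (le_trans _ dt)//.
  rewrite ler_pM2l// lef_pV2 ?posrE// ler_nat.
  by rewrite !ltnS.
have gf t : `]0, y]%classic t -> limn (g ^~ t) = (f t)%:E.
  rewrite /= in_itv/= => /andP[t0 ty]; apply: lim_near_cst => //.
  near=> n; rewrite /g patchE mem_set//= in_itv/= ty andbT.
  rewrite /d ler_pdivrMr// mulrC -ler_pdivrMr//.
  apply/ltW; rewrite -truncn_le_nat leqW//.
  by near: n; exact: nbhs_infty_ge.
have -> : (\int[mu]_(t in `]0%R, y]) (f t)%:E =
    \int[mu]_(t in `]0%R, y]) limn (g ^~ t))%E.
  by apply: eq_integral => t /set_mem/gf.
rewrite monotone_convergence//.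
apply: lime_le.
  apply: ereal_nondecreasing_is_cvgn => m n mn.
  apply: ge0_le_integral => //; [exact: mg|exact: mg|].
  by move=> t Dt; exact: (ndg t Dt m n mn).
near=> n; rewrite -integral_mkcondr.
have -> : `]0, y] `&` `[d n, y] = `[d n, y]%classic.
  have /andP[dn0 _] := d0 n.
  apply/seteqP; split=> t /=; rewrite !in_itv/=; first by case.
  by move=> /andP[dt ty]; split; rewrite ty andbT//; exact: lt_le_trans dt.
exact: fC.
Unshelve. all: by end_near. Qed.

(** Away from 0 the fundamental theorem of calculus applies; an inequality is
    enough, as it yields both integrability and the trivial bound. *)
Lemma integral_powR_le (a y : R) : -1 < a -> 0 < y ->
  (\int[mu]_(t in `[0%R, y]) (t `^ a)%:E <= (y `^ (1 + a) / (1 + a))%:E)%E.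
Proof.
move=> a1 y0; have a0 : 0 < 1 + a by lra.
apply: ge0_integral_itv0_le => //.
  by move=> t; exact: powR_ge0.
move=> d /andP[d0 dy].
pose F (t : R) := t `^ (1 + a) / (1 + a).
have dF (t : R) : 0 < t -> is_derive t 1 F (t `^ a).
  move=> t0; have := @is_derive1_powR R (1 + a) t t0 => ?.
  rewrite /F; apply: is_derive_eq; rewrite /GRing.scale/=.
  rewrite (_ : 1 + a - 1 = a); last by ring.
  by field; rewrite gt_eqF.
have cF (t : R) : 0 < t -> {for t, continuous F}.
  move=> t0; apply: differentiable_continuous; apply/derivable1_diffP.
  by have [] := dF t t0.
rewrite (@continuous_FTC2 _ _ F)//.
- rewrite -EFinB lee_fin lerBlDr lerDl divr_ge0 ?powR_ge0//; exact: ltW.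
- apply: derivable_within_continuous => t; rewrite in_itv/= => /andP[dt _].
  by have [] := @is_derive1_powR R a t (lt_le_trans d0 dt).
- split.
  + move=> t; rewrite in_itv/= => /andP[dt _].
    by have [] := dF t (lt_trans d0 dt).
  + by apply: cvg_at_right_filter; exact: cF.
  + by apply: cvg_at_left_filter; apply: cF; exact: lt_trans dy.
- move=> t; rewrite in_itv/= => /andP[dt _].
  by rewrite derive1E; have [] := dF t (lt_trans d0 dt).
Qed.

End powR_integral.

(** * From Lebesgue integrals to primitives *)

Section reflection.
Context {R : realType}.
Local Notation mu := (@lebesgue_measure R).
Local Notation opp := (-%R : R -> R).

Let pushforward_oppE (D : set R) (f : R -> \bar R) : measurable D ->
  (\int[pushforward mu (-%R : _ -> measurableTypeR R)]_(t in D) f t =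
   \int[mu]_(t in D) f t)%E.
Proof.
move=> mD; apply: eq_measure_integral => A mA _.
exact: lebesgue_measureN.
Qed.

(** The integrand is discontinuous at 0 when alpha < 0, so the change of
    variable is obtained from the invariance of Lebesgue measure rather than
    from a substitution rule for continuous functions. *)
Lemma integrable_oppr (D : set R) (f : R -> R) : measurable D ->
  measurable_fun [set: R] f ->
  mu.-integrable (opp @^-1` D) (EFin \o (f \o opp)) ->
  mu.-integrable D (EFin \o f).
Proof.
move=> mD mf intf; have mEf : measurable_fun [set: R] (EFin \o f).
  exact/measurable_EFinP.
apply/integrableP; split; first exact: (measurable_funS measurableT).
move/integrableP : intf => [_]; apply: le_lt_trans.
rewrite -pushforward_oppE// ge0_integral_pushforward//.
by apply: measurableT_comp => //; exact: (measurable_funS measurableT).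
Qed.

Lemma Rintegral_oppr (D : set R) (f : R -> R) : measurable D ->
  measurable_fun [set: R] f ->
  mu.-integrable (opp @^-1` D) (EFin \o (f \o opp)) ->
  \int[mu]_(t in D) f t = \int[mu]_(t in opp @^-1` D) f (- t).
Proof.
move=> mD mf intf; have mEf : measurable_fun [set: R] (EFin \o f).
  exact/measurable_EFinP.
rewrite /Rintegral -[X in fine X = _]pushforward_oppE//.
by rewrite integral_pushforward.
Qed.

Lemma integrable_setU (A B : set R) (f : R -> R) : measurable A ->
  measurable B -> mu.-integrable A (EFin \o f) ->
  mu.-integrable B (EFin \o f) -> mu.-integrable (A `|` B) (EFin \o f).
Proof.
move=> mA mB iA iB.
have iBA : mu.-integrable (B `\` A) (EFin \o f).
  by apply: integrableS iB => //; exact: measurableD.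
have -> : A `|` B = A `|` B `\` A by rewrite setDE setUIr setUv setIT.
have /integrableP[mfA fA] := iA; have /integrableP[mfB fB] := iBA.
have mU : measurable_fun (A `|` B `\` A) (EFin \o f).
  by apply/measurable_funU => //; exact: measurableD.
apply/integrableP; split=> //.
rewrite ge0_integral_setU//; first exact: lte_add_pinfty.
- exact: measurableD.
- exact: measurableT_comp.
- by apply/disj_setPS => t [/= ? []].
Qed.

End reflection.

Section osc_real.
Context {R : realType}.
Local Notation mu := (@lebesgue_measure R).
Variables (alpha b : R).
Hypothesis ha : -1 < alpha.

Definition osc_real (s theta t : R) : R :=
  cos (`|t| `^ b + s * t + theta) * `|t| `^ alpha.

Lemma osc_realN s theta t : osc_real s theta (- t) = osc_real (- s) theta t.
Proof. by rewrite /osc_real normrN mulrN mulNr. Qed.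

Let mpow p : measurable_fun [set: R] (fun t : R => `|t| `^ p).
Proof.
by apply: (measurableT_comp (measurable_powR p)); exact: normr_measurable.
Qed.

Lemma measurable_osc_real s theta : measurable_fun [set: R] (osc_real s theta).
Proof.
apply: measurable_funM; last exact: mpow.
apply: measurableT_comp.
  by apply: continuous_measurable_fun; exact: continuous_cos.
apply: measurable_funD => //; apply: measurable_funD; first exact: mpow.
exact: measurable_funM.
Qed.

Lemma integrable_powR_itv0 (y : R) : 0 < y ->
  mu.-integrable `[0, y] (EFin \o (fun t : R => t `^ alpha)).
Proof.
move=> y0; apply/integrableP; split.
  by apply/measurable_EFinP; apply: (measurable_funS measurableT).
apply: le_lt_trans (ltry (y `^ (1 + alpha) / (1 + alpha))).
apply: le_trans (integral_powR_le _ _ ha y0).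
rewrite le_eqVlt; apply/orP; left; apply/eqP.
by apply: eq_integral => t _ /=; rewrite ger0_norm// powR_ge0.
Qed.

Let osc_real_le s theta (t : R) : 0 <= t -> `|osc_real s theta t| <= t `^ alpha.
Proof.
move=> t0; rewrite /osc_real (ger0_norm t0) normrM (ger0_norm (powR_ge0 _ _)).
by rewrite ler_piMl ?powR_ge0// ler_norml cos_geN1 cos_le1.
Qed.

Lemma integrable_osc_real_itv0 s theta (y : R) : 0 < y ->
  mu.-integrable `[0, y] (EFin \o osc_real s theta).
Proof.
move=> y0; apply: le_integrable (integrable_powR_itv0 _ y0) => //.
  apply/measurable_EFinP; apply: (measurable_funS measurableT) => //.
  exact: measurable_osc_real.
move=> t /=; rewrite in_itv/= => /andP[t0 _].
by rewrite lee_fin (le_trans (osc_real_le _ _ _ t0))// ler_norm.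
Qed.

Lemma osc_primitive_Rintegral s theta :
  osc_primitive alpha b s theta
    (fun y => \int[mu]_(t in `[0, y]) osc_real s theta t).
Proof.
split=> y y0.
  have yy : y < y + 1 by rewrite ltrDl.
  have cy : {for y, continuous (osc_real s theta)}.
    apply: differentiable_continuous; apply/derivable1_diffP.
    apply: (@near_eq_derivable _ _ _
      (fun t => cos (half_line_phase b s theta t) * t `^ alpha)) => //.
      near=> t; have t0 : 0 < t by near: t; exact: lt_nbhsr.
      by rewrite /osc_real /half_line_phase gtr0_norm.
    have := @is_derive1_powR R b y y0 => ?.
    have := @is_derive1_powR R alpha y y0 => ?.
    by rewrite /half_line_phase; exact: ex_derive.
  have [d1 d2] := @continuous_FTC1_closed R (osc_real s theta) 0 y (y + 1) yy
    (integrable_osc_real_itv0 s theta _ (addr_gt0 y0 ltr01)) y0 cy.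
  split; first exact: d1.
  by rewrite -derive1E d2 /osc_real /half_line_phase gtr0_norm.
have intf := integrable_osc_real_itv0 s theta y y0.
apply: le_trans (le_normr_Rintegral _ intf) _ => //.
have /integrableP[_ foo] := intf.
rewrite -lee_fin; apply: le_trans (integral_powR_le _ _ ha y0).
rewrite fineK; last first.
  rewrite ge0_fin_numE//; exact: integral_ge0.
apply: ge0_le_integral => //.
- by apply/measurable_EFinP/measurableT_comp => //;
    apply: (measurable_funS measurableT) => //; exact: measurable_osc_real.
- by apply/measurable_EFinP; apply: (measurable_funS measurableT).
- by move=> t /=; rewrite in_itv/= => /andP[t0 _]; rewrite lee_fin osc_real_le.
Unshelve. all: by end_near. Qed.

Lemma Rintegral_osc_real s theta (r1 r2 : R) : 0 < r1 -> 0 < r2 ->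
  \int[mu]_(t in `[- r1, r2]) osc_real s theta t =
  \int[mu]_(t in `[0, r1]) osc_real (- s) theta t +
  \int[mu]_(t in `[0, r2]) osc_real s theta t.
Proof.
move=> r10 r20.
have oppD : (-%R : R -> R) @^-1` `[- r1, 0] = `[0, r1]%classic.
  by apply/seteqP; split=> t /=; rewrite !in_itv/= lerN2 oppr_le0 andbC.
have oppf : osc_real s theta \o -%R = osc_real (- s) theta.
  by apply/funext => t /=; exact: osc_realN.
have int1 : mu.-integrable ((-%R : R -> R) @^-1` `[- r1, 0])
    (EFin \o (osc_real s theta \o -%R)).
  by rewrite oppD oppf; exact: integrable_osc_real_itv0.
have int2 : mu.-integrable `[- r1, 0] (EFin \o osc_real s theta).
  by apply: integrable_oppr => //; exact: measurable_osc_real.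
have int3 := integrable_osc_real_itv0 s theta r2 r20.
have int4 : mu.-integrable `[- r1, r2] (EFin \o osc_real s theta).
  rewrite (@itv_bndbnd_setU _ _ _ (BLeft 0)) ?bnd_simp ?oppr_le0 ?ltW//.
  apply: integrable_setU => //; apply: integrableS int2 => //.
  exact: subset_itv_co_cc.
have := @Rintegral_itvB R (osc_real s theta) (BLeft (- r1)) (BRight r2) 0 int4.
rewrite !bnd_simp oppr_le0 => /(_ (ltW r10) (ltW r20)).
rewrite Rintegral_itv_obnd_cbnd; last first.
  by apply: integrableS int3 => //; exact: subset_itv_oc_cc.
move=> <-; rewrite (Rintegral_oppr _ _ _ _ int1)//; last first.
  exact: measurable_osc_real.
rewrite oppD.
under [X in _ = X + _]eq_Rintegral do rewrite -osc_realN.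
by rewrite addrC subrK.
Qed.

End osc_real.

(** * The complex oscillatory integral *)

Section complex_limits.
Context {R : realType}.

Lemma normc_le_Re_Im (p q : R) : Normc.normc (p +i* q)%C <= `|p| + `|q|.
Proof.
rewrite /= -[leRHS]ger0_norm ?addr_ge0// -sqrtr_sqr ler_wsqrtr// sqrrD.
rewrite !real_normK ?num_real//.
by rewrite addrAC lerDl mulrn_wge0// mulr_ge0.
Qed.

Lemma cvg_complex (T : Type) (F : set_system T) (FF : Filter F)
    (f g : T -> R) (p q : R) :
  f @ F --> p -> g @ F --> q ->
  (fun t => (f t +i* g t)%C : R[i]^o) @ F --> ((p +i* q)%C : R[i]^o).
Proof.
move=> fp gq; apply/cvgrPdist_lt => -[e e'].
rewrite ltcE/= => /andP[/eqP -> e0].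
have e2 : 0 < e / 2 by rewrite divr_gt0.
move/cvgrPdist_lt/(_ _ e2) : fp => fp2; move/cvgrPdist_lt/(_ _ e2) : gq => gq2.
near=> t.
have ft : `|p - f t| < e / 2 by near: t.
have gt : `|q - g t| < e / 2 by near: t.
have -> : (p +i* q)%C - (f t +i* g t)%C =
  ((p - f t) +i* (q - g t))%C :> R[i] by [].
rewrite -[ltLHS]/((Normc.normc _)%:C)%C ltcR.
apply: le_lt_trans (normc_le_Re_Im _ _) _; lra.
Unshelve. all: by end_near. Qed.

End complex_limits.

Section osc_integral.
Context {R : realType}.
Variables (alpha b : R).
Hypotheses (hb : 1 < b) (ha : -1 < alpha) (hab : alpha < b - 1).
Local Notation mu := (@lebesgue_measure R).

#[local] Instance osc_filter_proper : ProperFilter (osc_filter R).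
Proof. exact: filter_prod_proper. Qed.

Lemma osc_partialE x (r : R * R) :
  osc_partial b alpha x r =
  ((\int[mu]_(t in `[- r.1, r.2]) osc_real alpha b x 0 t) +i*
   (\int[mu]_(t in `[- r.1, r.2]) osc_real alpha b x (- (pi / 2)) t))%C.
Proof.
rewrite /osc_partial /cintegral /osc_integrand /expi /osc_real.
congr (_ +i* _)%C; apply: eq_Rintegral => t _ /=.
  by rewrite mulr0 subr0 addr0.
by rewrite mulr0 add0r cosBpihalf.
Qed.

Lemma cvg_osc_real C e x theta :
  (forall s theta F, osc_primitive alpha b s theta F ->
    \forall y \near +oo, `|F y| <= C * (1 + `|s|) `^ e) ->
  exists2 l : R,
    (fun r : R * R => \int[mu]_(t in `[- r.1, r.2]) osc_real alpha b x theta t)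
      @ osc_filter R --> l &
    `|l| <= 2 * (C * (1 + `|x|) `^ e).
Proof.
move=> bound.
pose F (s : R) y := \int[mu]_(t in `[0, y]) osc_real alpha b s theta t.
have oF s : osc_primitive alpha b s theta (F s).
  exact: osc_primitive_Rintegral.
have cF s : F s y @[y --> +oo] --> lim (F s y @[y --> +oo]).
  exact: (cvg_osc_primitive _ _ hb hab _ _ _ (oF s)).
have bF s : `|s| = `|x| ->
    `|lim (F s y @[y --> +oo])| <= C * (1 + `|x|) `^ e.
  move=> <-; apply: (cvgr_to_le (cvg_norm (cF s))).
  exact: bound (oF s).
exists (lim (F (- x) y @[y --> +oo]) + lim (F x y @[y --> +oo])); last first.
  apply: le_trans (ler_normD _ _) _.
  by have := bF _ (normrN x); have := bF _ (erefl `|x|); lra.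
have cD : (fun r : R * R => F (- x) r.1 + F x r.2) @ osc_filter R -->
    lim (F (- x) y @[y --> +oo]) + lim (F x y @[y --> +oo]).
  by apply: cvgD; [apply: cvg_comp (cF _); exact: cvg_fst|
                   apply: cvg_comp (cF _); exact: cvg_snd].
apply: cvg_trans cD; apply: near_eq_cvg.
have pos1 : \forall r \near osc_filter R, 0 < r.1.
  exact: (@filter_prod1 _ _ (pinfty_nbhs R) (pinfty_nbhs R) _ (fun z => 0 < z)
    (nbhs_pinfty_gt (num_real 0))).
have pos2 : \forall r \near osc_filter R, 0 < r.2.
  exact: (@filter_prod2 _ _ (pinfty_nbhs R) (pinfty_nbhs R) _ (fun z => 0 < z)
    (nbhs_pinfty_gt (num_real 0))).
near=> r; rewrite /F Rintegral_osc_real//; first by near: r.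
by near: r.
Unshelve. all: by end_near. Qed.

Lemma osc_integral_le e :
  - ((b - 1) * (1 + alpha)) <= (b - 1) * e ->
  alpha + 1 - b / 2 <= (b - 1) * e ->
  exists2 C : R, 0 < C & forall x : R,
    osc_converges b alpha x /\
    Normc.normc (osc_integral b alpha x) <= C * (1 + `|x|) `^ e.
Proof.
move=> eP eQ; have [C C0 bound] := osc_primitive_bound _ _ hb ha hab e eP eQ.
exists (4 * C); first by rewrite mulr_gt0.
move=> x.
have [p cp bp] := cvg_osc_real C e x 0 bound.
have [q cq bq] := cvg_osc_real C e x (- (pi / 2)) bound.
have cpq : osc_partial b alpha x @ osc_filter R --> ((p +i* q)%C : R[i]^o).
  by rewrite (funext (osc_partialE x)); exact: cvg_complex cp cq.
split; first by apply/cvg_ex; exists (p +i* q)%C.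
have -> : osc_integral b alpha x = (p +i* q)%C.
  by apply: cvg_lim cpq; exact: norm_hausdorff.
apply: le_trans (normc_le_Re_Im _ _) _; lra.
Qed.

End osc_integral.

(** For either exponent e of the statement, the two hypotheses of
    [osc_integral_le] reduce to an equality and to the sign of
    b (alpha + 1/2). *)
Theorem proposition4p4 (R : realType) (alpha b : R) (hb : 1 < b) :
  exists2 C : R, 0 < C & forall x : R,
    (-1 < alpha <= - (1 / 2) ->
       osc_converges b alpha x /\
       Normc.normc (osc_integral b alpha x)
         <= C * (1 + `|x|) `^ (- 1 - alpha)) /\
    (- (1 / 2) < alpha < b - 1 ->
       osc_converges b alpha x /\
       Normc.normc (osc_integral b alpha x)
         <= C * (1 + `|x|) `^ (1 / (b - 1) * (alpha - b / 2 + 1))).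
Proof.
have b10 : 0 < b - 1 by lra.
have [/andP[a1 a2]|_] := boolP (-1 < alpha <= - (1 / 2)).
  have [||C C0 hC] := @osc_integral_le R alpha b hb a1 ltac:(lra) (- 1 - alpha).
  - lra.
  - have : b * (alpha + 1 / 2) <= 0 by apply: mulr_ge0_le0; lra.
    lra.
  exists C => // x; split => [_|/andP[? _]]; first exact: hC.
  by exfalso; lra.
have [/andP[a1 a2]|_] := boolP (- (1 / 2) < alpha < b - 1).
  have E : (b - 1) * (1 / (b - 1) * (alpha - b / 2 + 1)) = alpha - b / 2 + 1.
    by field; lra.
  have [||C C0 hC] := @osc_integral_le R alpha b hb ltac:(lra) a2
    (1 / (b - 1) * (alpha - b / 2 + 1)); rewrite ?E.
  - have : 0 <= b * (alpha + 1 / 2) by apply: mulr_ge0; lra.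
    lra.
  - lra.
  by exists C.
by exists 1 => // x; split.
Qed.
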